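(* Let $X=[0,1]\subset\mathbb{R}$, let $\boldsymbol{\xi},\boldsymbol{\xi}^1,\boldsymbol{\xi}^2,\ldots$ be iid random variables on a complete probability space $(\Omega,\mathcal{F},\mathbb{P})$, each uniformly distributed on $\Xi=[0,1]$, and let $f:\Xi\times\mathbb{R}\to\mathbb{R}$ and $\{\delta^\nu\}_{\nu\in\mathbb{N}}\subset(0,1]$ be the function and sequence defined explicitly in the context. Then the following hold. (a) For any $\xi\in\Xi$, the set-valued mapping $\partial_x f(\xi,\cdot)$ is outer semicontinuous, with $\sup_{z\in\partial_x f(\xi,x)}|z|\le 1$ for all $x\in\mathbb{R}$. (b) For any $x\in\mathbb{R}$, the set-valued mapping $\partial_x f(\cdot,x)$ is measurable. (c) For any sequence $\{r^\nu\}_\nu$ with $r^\nu\in[0,\delta^\nu]$ for all $\nu$, $\mathbb{P}$-almost surely, one has $$\liminf_{\nu\to\infty}\sup_{x\in X}\operatorname{exs}\Big(\frac1\nu\sum_{i=1}^\nu\partial_x f(\boldsymbol{\xi}^i,x);\ \bigcup_{y\in\mathbb{B}(x,r^\nu)\cap X}\mathbb{E}[\partial_x f(\boldsymbol{\xi},y)]\Big)\ge\frac12,$$ $$\liminf_{\nu\to\infty}\sup_{x\in X}\operatorname{exs}\Big(\mathbb{E}[\partial_x f(\boldsymbol{\xi},x)];\ \bigcup_{y\in\mathbb{B}(x,r^\nu)\cap X}\frac1\nu\sum_{i=1}^\nu\partial_x f(\boldsymbol{\xi}^i,y)\Big)\ge\frac12 .$$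
   Context: $\mathbb{N}=\{1,2,\ldots\}$. Definition of $f$ and $\delta^\nu$: for $\xi\in[0,1]$ and $k\in\mathbb{N}$ let $\mathrm{bit}_k(\xi)=\lfloor 2^k\xi\rfloor-2\lfloor 2^{k-1}\xi\rfloor\in\{0,1\}$. Let $B_k=\{x\in\mathbb{R}\mid |x-\frac1k|<\frac{1}{4k^2}\}$ for $k\in\mathbb{N}$ (these sets are pairwise disjoint), let $g(\xi,x)=\sum_{k=1}^\infty \mathds{1}_{B_k}(x)\,\mathrm{bit}_k(\xi)$, where $\mathds{1}_{B_k}$ is the $\{0,1\}$-valued indicator function of $B_k$, and let $$f(\xi,x)=\int_0^{\max\{x,0\}}g(\xi,t)\,dt,\qquad \delta^\nu=\big(8\lceil 2^{\nu+1}\ln(\nu+1)\rceil^2\big)^{-1}.$$ Notation: $\partial_x f(\xi,x)$ is the Clarke subdifferential of $f(\xi,\cdot)$ at $x$. $\mathbb{B}(x,r)=\{y\mid|y-x|\le r\}$. Sums and scalings of sets are in the Minkowski sense. A set-valued mapping $S:\Xi\rightrightarrows\mathbb{R}^d$ is measurable if $\{\xi\in\Xi\mid S(\xi)\cap C\ne\emptyset\}$ is Borel for every open $C\subset\mathbb{R}^d$; its expectation $\mathbb{E}[S(\boldsymbol{\xi})]$ is the Aumann expectation, i.e., the set of all $\mathbb{E}[s(\boldsymbol{\xi})]$ over measurable integrable selections $s(\xi)\in S(\xi)$. A set-valued mapping $S$ is outer semicontinuous if $x_n\to x$, $z_n\in S(x_n)$, $z_n\to z$ imply $z\in S(x)$.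 For nonempty sets $C,D$, $\operatorname{dist}(z,D)=\inf_{w\in D}\|z-w\|$ and the excess of $C$ relative to $D$ is $\operatorname{exs}(C;D)=\sup_{z\in C}\operatorname{dist}(z,D)$. ''$\mathbb{P}$-almost surely'' means for all $\omega$ in a set of $\mathbb{P}$-probability one (the probability space is complete). *)

(* Defs.v *)
From mathcomp Require Import all_boot all_order all_algebra.
From mathcomp Require Import all_classical all_reals all_analysis.

Set Implicit Arguments.
Unset Strict Implicit.
Unset Printing Implicit Defensive.
Import Order.TTheory GRing.Theory Num.Theory.
Import numFieldNormedType.Exports.

Local Open Scope classical_set_scope.
Local Open Scope ring_scope.

Section integrand.
Context {R : realType}.

(* [bit] and [bump_set] are only used for k >= 1. *)
Definition bit (k : nat) (xi : R) : int :=
  Num.floor (2 ^+ k * xi) - 2 * Num.floor (2 ^+ k.-1 * xi).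

Definition bump_set (k : nat) : set R :=
  [set x | `|x - k%:R^-1| < (4 * k%:R ^+ 2)^-1].

(* The sets [bump_set k], k >= 1, are pairwise disjoint, so at each [x] the
   series has at most one nonzero term. *)
Definition g (xi x : R) : R :=
  limn (fun n : nat => (\sum_(1 <= k < n) \1_(bump_set k) x * (bit k xi)%:~R) : R).

Definition f (xi x : R) : R :=
  \int[lebesgue_measure]_(t in `[0, Num.max x 0]) g xi t.

End integrand.

Definition delta (R : realType) (nu : nat) : R :=
  (8 * (Num.ceil (2 ^+ nu.+1 * ln (nu.+1%:R : R)))%:~R ^+ 2)^-1.

Section clarke.
Context {R : realType}.

(* limsup of (h (y + t v) - h y) / t as y --> x and t decreases to 0. *)
Definition clarke_dderiv (h : R -> R) (x v : R) : \bar R :=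
  limf_esup (fun p : R * R => ((h (p.1 + p.2 * v) - h p.1) / p.2)%:E)
    (filter_prod (nbhs x) (0^'+)).

(* Meaningful when [h] is Lipschitz continuous near [x]. *)
Definition clarke_subdiff (h : R -> R) (x : R) : set R :=
  [set z | forall v : R, ((z * v)%:E <= clarke_dderiv h x v)%E].

End clarke.

Section set_valued.
Context {R : realType}.

Definition outer_semicontinuous (S : R -> set R) :=
  forall (u z : nat -> R) (x0 z0 : R),
    u n @[n --> \oo] --> x0 -> (forall n, S (u n) (z n)) ->
    z n @[n --> \oo] --> z0 -> S x0 z0.

(* Measurability of a set-valued mapping with domain [Xi]; for a Borel [Xi],
   the Borel subsets of [Xi] are the Borel subsets of [R] contained in [Xi]. *)
Definition set_measurable (Xi : set R) (S : R -> set R) :=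
  forall C : set R, open C ->
    measurable [set xi | Xi xi /\ S xi `&` C !=set0].

Definition mink_add (A B : set R) : set R := [set a + b | a in A & b in B].

Definition mink_scale (c : R) (A : set R) : set R := [set c * a | a in A].

Definition mink_avg (nu : nat) (A : nat -> set R) : set R :=
  mink_scale (nu%:R^-1) (\big[mink_add/[set 0]]_(1 <= i < nu.+1) A i).

Definition dist (z : R) (D : set R) : \bar R :=
  ereal_inf [set `|z - w|%:E | w in D].

(* Meant for nonempty [C] and [D]. *)
Definition exs (C D : set R) : \bar R := ereal_sup [set dist z D | z in C].

End set_valued.

Section random.
Context {d : measure_display} {T : measurableType d} {R : realType}.
Variable P : probability T R.

(* The Aumann expectation of [S (X w)], for an [X] with values in [Xi];
   selections are everywhere-defined Borel functions on [Xi]. *)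
Definition aumann (X : {RV P >-> R}) (Xi : set R) (S : R -> set R) : set R :=
  [set e | exists s : R -> R,
    [/\ measurable_fun Xi s,
        forall xi, Xi xi -> S xi (s xi),
        P.-integrable setT (fun w => (s (X w))%:E) &
        'E_P[fun w => s (X w)]%E = e%:E]].

Definition mutually_independent (X : nat -> {RV P >-> R}) :=
  forall (J : seq nat) (A : nat -> set R), uniq J ->
    (forall j, measurable (A j)) ->
    P (\bigcap_(j in [set` J]) (X j @^-1` A j)) =
    (\prod_(j <- J) P (X j @^-1` A j))%E.

Definition uniformly_distributed01 (X : {RV P >-> R}) :=
  forall A : set R, measurable A ->
    distribution P X A = uniform_prob (@ltr01 R) A.

End random.

(* Main.v *)
(** On [bump_set k] the function [f xi] is affine with slope [bit k xi], so there
    its Clarke subdifferential is [{bit k xi}] and the Aumann expectation is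
    [{1/2}]. A sample average over the first [nu] variables equals [{1}] on that
    bump as soon as the k-th bits of all of them are 1. The bits of a uniform
    variable are fair and independent, hence with K the ceiling in [delta] the
    probability that no [k <= K] has this property is
    (1 - 2^-nu)^K <= exp(-K/2^nu) <= 1/(nu+1)^2, which is summable. By
    Borel-Cantelli such a [k] almost surely exists for all large [nu], and
    [delta nu] is small enough for the ball around [1/k] to stay in
    [bump_set k], which separates the two sets by 1/2.

    Away from [x = 0] only finitely many bits of [xi] influence the
    subdifferential at [x]; at [x = 0] it is [[0, 1]] if infinitely many bits
    are 1, and the one of [f 0] otherwise. *)
Require Import Defs.
From mathcomp Require Import all_boot all_order all_algebra.
From mathcomp Require Import all_classical all_reals all_analysis.
From mathcomp Require Import measurable_realfun zify ring lra.
Import Order.TTheory GRing.Theory Num.Theory.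
Import numFieldNormedType.Exports.
Local Open Scope classical_set_scope.
Local Open Scope ring_scope.

Set Implicit Arguments.
Unset Strict Implicit.

(** * Binary digits and the integrand *)

Section bits.
Context {R : realType}.
Implicit Types (x y xi : R) (k n : nat).

Lemma floor_double x :
  Num.floor (2 * x) = 2 * Num.floor x \/ Num.floor (2 * x) = 2 * Num.floor x + 1.
Proof.
have /andP[lx ux] := floor_itv x; rewrite intrD in ux.
have [h|h] := ltP x ((Num.floor x)%:~R + 2^-1); [left|right];
  by apply: floor_def; apply/andP; split; rewrite !(intrD, intrM); lra.
Qed.

Lemma floor_expS k x : 2 ^+ k.+1 * x = 2 * (2 ^+ k * x).
Proof. by rewrite exprS mulrA. Qed.

Lemma bit01 k xi : (0 < k)%N -> bit k xi = 0 \/ bit k xi = 1.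
Proof.
case: k => // k _; rewrite /bit /= floor_expS.
by case: (floor_double (2 ^+ k * xi)) => ->; [left|right]; ring.
Qed.

Lemma bit0 k : bit k (0 : R) = 0.
Proof. by rewrite /bit !mulr0 floor0. Qed.

(** The floor at one finer level is [2m] or [2m + 1], with [m] the coarser floor, so parity recovers
    [m]; descend from [n] to [k]. *)
Lemma floor_dyadic_le {k n x y} : (k <= n)%N ->
  Num.floor (2 ^+ n * x) = Num.floor (2 ^+ n * y) ->
  Num.floor (2 ^+ k * x) = Num.floor (2 ^+ k * y).
Proof.
move=> /subnK <-; elim: (n - k)%N => // m IH; rewrite addSn !floor_expS => E.
apply: IH; move: E.
by case: (floor_double (2 ^+ (m + k) * x)) => ->;
  case: (floor_double (2 ^+ (m + k) * y)) => ->; lia.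
Qed.

Lemma bit_dyadic {k n x y} : (k <= n)%N ->
  Num.floor (2 ^+ n * x) = Num.floor (2 ^+ n * y) -> bit k x = bit k y.
Proof.
move=> kn E; rewrite /bit (floor_dyadic_le kn E).
by rewrite (floor_dyadic_le (leq_trans (leq_pred k) kn) E).
Qed.

(** By definition of [bit], the floor at level [n.+1] is twice the one at level [n] plus bit [n.+1],
    so the integer part and the bits rebuild it. *)
Lemma dyadic_bits n x y : Num.floor x = Num.floor y ->
  (forall k, (0 < k <= n)%N -> bit k x = bit k y) ->
  Num.floor (2 ^+ n * x) = Num.floor (2 ^+ n * y).
Proof.
move=> E; elim: n => [|n IH] b; first by rewrite !expr0 !mul1r.
have := b n.+1; rewrite /bit /= ltnSn => /(_ isT).
rewrite IH; first lia.
by move=> k /andP[k0 kn]; apply: b; rewrite k0 ltnW.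
Qed.

(** Such an [A] is a countable union of dyadic intervals of length [2^-n]. Measurability of sets
    described by finitely many bits reduces to this. *)
Lemma measurable_dyadic n (A : set R) :
  (forall x y, Num.floor (2 ^+ n * x) = Num.floor (2 ^+ n * y) -> A x -> A y) ->
  measurable A.
Proof.
move=> hA.
have n0 : (0 : R) < 2 ^+ n by rewrite exprn_gt0.
(* [I m] is the [m]-th dyadic cell if [A] meets it, in which case [A] contains it, and empty
   otherwise. *)
pose I (m : int) : set R := if `[< exists2 x, A x & Num.floor (2 ^+ n * x) = m >]
  then `[m%:~R / 2 ^+ n, (m + 1)%:~R / 2 ^+ n[%classic else set0.
have -> : A = \bigcup_m I m.
  apply/seteqP; split => [x Ax|x [m _]].
    exists (Num.floor (2 ^+ n * x)) => //; rewrite /I asboolT; last by exists x.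
    by rewrite /= in_itv /= ler_pdivrMr// ltr_pdivlMr// mulrC floor_itv.
  rewrite /I; case: asboolP => // -[y Ay ym].
  rewrite /= in_itv /= ler_pdivrMr// ltr_pdivlMr// mulrC => h.
  by apply: hA Ay; rewrite ym; apply/esym/floor_def.
apply: countable_bigcupT_measurable => // m.
by rewrite /I; case: asboolP => // _; exact: measurable_itv.
Qed.

Lemma measurable_bit k (b : int) : measurable [set x : R | bit k x = b].
Proof. by apply: (@measurable_dyadic k) => x y /(bit_dyadic (leqnn k)) /= ->. Qed.

End bits.

(** * The bumps and the pointwise values of [g] *)

Section bumps.
Context {R : realType}.
Implicit Types (x y xi : R) (k n : nat).

Lemma bump_setP k x : (0 < k)%N -> bump_set k x ->
  2^-1 * k%:R^-1 < x /\ x < 2 * k%:R^-1.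
Proof.
move=> k0; rewrite /bump_set /= ltr_norml invfM -exprVn => /andP[].
have : 0 < (k%:R : R)^-1 <= 1 by rewrite invr_gt0 ltr0n k0/= invf_le1 ?ltr0n// ler1n.
by move: (k%:R^-1) => u /andP[u0 u1] h1 h2; split; nra.
Qed.

Lemma bump_center k : (0 < k)%N -> bump_set k (k%:R^-1 : R).
Proof. by move=> k0; rewrite /bump_set /= subrr normr0 invr_gt0 mulr_gt0// exprn_gt0// ltr0n. Qed.

(** With [u = 1/j] and [v = 1/k], the distance of the centres is [u - v = uv(k - j) >= uv]. Hence
    [u^2 + v^2 = (u - v)^2 + 2uv <= 3(u - v)], so the radii [u^2/4] and [v^2/4] add up to less than
    [u - v]. *)
Lemma bump_disj_lt j k x : (0 < j < k)%N -> bump_set j x -> ~ bump_set k x.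
Proof.
move=> /andP[j0 jk]; rewrite /bump_set /= !ltr_norml !invfM.
move=> /andP[h1 h2] /andP[h3 h4].
have j0' : 0 < (j%:R : R) by rewrite ltr0n.
have k0' : 0 < (k%:R : R) by rewrite ltr0n (leq_trans _ jk).
have : (j%:R : R) * j%:R^-1 = 1 by rewrite mulfV// gt_eqF.
have : (k%:R : R) * k%:R^-1 = 1 by rewrite mulfV// gt_eqF.
have : (j%:R : R) + 1 <= k%:R by rewrite natr1 ler_nat.
have : 0 < (j%:R : R)^-1 <= 1 by rewrite invr_gt0 j0' /= invf_le1// ler1n.
have : 0 < (k%:R : R)^-1 by rewrite invr_gt0.
move: (j%:R^-1) (k%:R^-1) h1 h2 h3 h4 => u v h1 h2 h3 h4 v0 /andP[u0 u1] jk1 kv ju.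
have uv0 : 0 < u * v by rewrite mulr_gt0.
have E : u * v * (k%:R - j%:R) = u - v.
  transitivity (u * (k%:R * v) - v * (j%:R * u)); first ring.
  by rewrite kv ju !mulr1.
have uv : u * v <= u - v by nra.
nra.
Qed.

Lemma bump_disj {j k x} : (0 < j)%N -> (0 < k)%N ->
  bump_set j x -> bump_set k x -> j = k.
Proof.
move=> j0 k0 hj hk; case: (ltngtP j k) => // h.
  by case: (@bump_disj_lt j k x); rewrite ?j0.
by case: (@bump_disj_lt k j x); rewrite ?k0.
Qed.

Lemma open_bump k : open (bump_set k : set R).
Proof.
rewrite /bump_set; rewrite (_ : [set x | _] = ball (k%:R^-1 : R) (4 * k%:R ^+ 2)^-1).
  exact: ball_open.
by apply/seteqP; split => x /=; rewrite /ball /= distrC.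
Qed.

Definition gsum xi n x : R :=
  \sum_(1 <= k < n) \1_(bump_set k) x * (bit k xi)%:~R.

Lemma gsum_bump xi k x n : (0 < k < n)%N -> bump_set k x ->
  gsum xi n x = (bit k xi)%:~R.
Proof.
move=> /andP[k0 kn] hk; rewrite /gsum (big_cat_nat (n := k))//=; last exact: ltnW.
rewrite [X in _ + X]big_ltn//= big1_seq ?add0r; last first.
  move=> i /andP[_]; rewrite mem_index_iota => /andP[i1 ik].
  rewrite indicE memNset ?mul0r// => hi.
  by have := bump_disj i1 k0 hi hk; move: ik => /[swap] ->; rewrite ltnn.
rewrite indicE mem_set// mul1r big1_seq ?addr0// => i /andP[_].
rewrite mem_index_iota => /andP[ki _].
rewrite indicE memNset ?mul0r// => hi.
by have := bump_disj (ltn_trans k0 ki) k0 hi hk; move: ki => /[swap] ->; rewrite ltnn.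
Qed.

Lemma gsum_out xi x n : (forall k, (0 < k)%N -> ~ bump_set k x) -> gsum xi n x = 0.
Proof.
move=> h; rewrite /gsum big1_seq// => i /andP[_]; rewrite mem_index_iota => /andP[i1 _].
by rewrite indicE memNset ?mul0r//; exact: h.
Qed.

Variant bump_spec x : Prop :=
| InBump k of (0 < k)%N & bump_set k x
| OutBump of (forall k, (0 < k)%N -> ~ bump_set k x).

Lemma bumpP x : bump_spec x.
Proof.
have [[k k0 hk]|h] := pselect (exists2 k, (0 < k)%N & bump_set k x); first exact: InBump hk.
by apply: OutBump => k k0 hk; apply: h; exists k.
Qed.

Lemma gsum_cvg_bump xi k x : (0 < k)%N -> bump_set k x ->
  gsum xi n x @[n --> \oo] --> ((bit k xi)%:~R : R).
Proof.
move=> k0 hk; apply: cvg_near_cst; exists k.+1 => // n /= kn.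
by rewrite (@gsum_bump _ k)// k0.
Qed.

Lemma gsum_cvg_out xi x : (forall k, (0 < k)%N -> ~ bump_set k x) ->
  gsum xi n x @[n --> \oo] --> (0 : R).
Proof. by move=> h; apply: cvg_near_cst; apply: nearW => n; rewrite gsum_out. Qed.

Lemma g_bump xi k x : (0 < k)%N -> bump_set k x -> g xi x = (bit k xi)%:~R.
Proof. by move=> k0 hk; apply/cvg_lim => //; exact: gsum_cvg_bump. Qed.

Lemma g_out xi x : (forall k, (0 < k)%N -> ~ bump_set k x) -> g xi x = 0.
Proof. by move=> h; apply/cvg_lim => //; exact: gsum_cvg_out. Qed.

Lemma gsum_cvg xi x : gsum xi n x @[n --> \oo] --> g xi x.
Proof.
case: (bumpP x) => [k k0 hk|h].
  by rewrite (g_bump _ k0 hk); exact: gsum_cvg_bump.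
by rewrite g_out//; exact: gsum_cvg_out.
Qed.

Lemma g01 xi x : 0 <= g xi x <= 1.
Proof.
case: (bumpP x) => [k k0 hk|h]; last by rewrite g_out// lexx ler01.
by rewrite (g_bump _ k0 hk); case: (bit01 xi k0) => ->; rewrite ?lexx ler01.
Qed.

Lemma eq_g xi xi' x :
  (forall k, (0 < k)%N -> bump_set k x -> bit k xi = bit k xi') ->
  g xi x = g xi' x.
Proof.
move=> E; case: (bumpP x) => [k k0 hk|h]; last by rewrite !g_out.
by rewrite !(g_bump _ k0 hk) E.
Qed.

Lemma measurable_g xi (D : set R) : measurable_fun D (g xi).
Proof.
apply: (@measurable_fun_cvg _ _ _ _ (gsum xi)); last by move=> x _; exact: gsum_cvg.
move=> n; apply: (@measurable_sum _ _ _ _ _ _ (fun k x => \1_(bump_set k) x * (bit k xi)%:~R)) => k.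
by apply: measurable_funM => //; apply: measurable_indic; apply: open_measurable; exact: open_bump.
Qed.

End bumps.

(** * Increments of the integrand [f] *)

Section primitive.
Context {R : realType}.
Implicit Types (x y u v xi : R) (k n : nat).
Local Notation mu := (@lebesgue_measure R).

Lemma integrable_g xi (i : interval R) a b : [set` i] `<=` `[a, b]%classic ->
  mu.-integrable [set` i] (EFin \o g xi).
Proof.
move=> iab; apply: (@integrableS _ _ _ mu _ _ (EFin \o g xi) _ _ iab) => //.
apply: measurable_bounded_integrable => //.
- by rewrite /= lebesgue_measure_itv; case: ifP => // _; rewrite ltry.
- exact: measurable_g.
- exists 1; split => // M M1 x _; have /andP[g0 g1] := g01 xi x.
  by rewrite /= ger0_norm// (le_trans g1)// ltW.
Qed.

(** Clarke derivatives only see increments of [f]; the clipping at 0 moves into the endpoints. *)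
Lemma f_sub xi u v : u <= v ->
  f xi v - f xi u =
  \int[mu]_(t in `]Num.max u 0, Num.max v 0]) g xi t.
Proof.
move=> uv; rewrite /f; apply: Rintegral_itvB.
- exact: (@integrable_g xi _ 0 (Num.max v 0)).
- by rewrite bnd_simp le_max lexx orbT.
- by rewrite bnd_simp ge_max !le_max uv lexx orbT.
Qed.

Lemma f_sub_cst xi u v a : u <= v ->
  (forall t, u < t <= v -> 0 < t -> g xi t = a) ->
  f xi v - f xi u = a * (Num.max v 0 - Num.max u 0).
Proof.
move=> uv ga; rewrite f_sub// (@eq_Rintegral _ _ _ mu _ (cst a)); last first.
  move=> t; rewrite inE /= in_itv /= gt_max le_max => /andP[/andP[ut t0] tv].
  by apply: ga => //; rewrite ut /=; case/orP: tv => //; rewrite leNgt t0.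
rewrite Rintegral_cst//= lebesgue_measure_itv /= lte_fin; congr (_ * _).
case: ltP => // h; apply/esym/eqP; rewrite subr_eq0 eq_le h /=.
by rewrite ge_max !le_max uv lexx orbT.
Qed.

Lemma eq_f_sub xi xi' u v : u <= v ->
  (forall t, u < t <= v -> g xi t = g xi' t) ->
  f xi v - f xi u = f xi' v - f xi' u.
Proof.
move=> uv gg; rewrite (f_sub xi uv) (f_sub xi' uv); apply: eq_Rintegral.
move=> t; rewrite inE /= in_itv /= gt_max le_max => /andP[/andP[ut t0] tv].
by apply: gg; rewrite ut /=; case/orP: tv => //; rewrite leNgt t0.
Qed.

Lemma f_sub_bounds xi u v : u <= v -> 0 <= f xi v - f xi u <= v - u.
Proof.
move=> uv; rewrite f_sub//; apply/andP; split.
  by apply: Rintegral_ge0 => t _; case/andP: (g01 xi t).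
have uv0 : Num.max u 0 <= Num.max v 0 by rewrite ge_max !le_max uv lexx orbT.
apply: (@le_trans _ _ (\int[mu]_(t in `]Num.max u 0, Num.max v 0]) cst 1 t)).
  apply: le_Rintegral => //.
  - apply: (@integrable_g xi _ (Num.max u 0) (Num.max v 0)).
    by apply: subset_itvr; rewrite bnd_simp.
  - apply: measurable_bounded_integrable => //.
      by rewrite /= lebesgue_measure_itv; case: ifP => // _; rewrite ltry.
    by exists 1; split => // M M1 x _; rewrite /= normr1 ltW.
  - by move=> t _; case/andP: (g01 xi t).
rewrite Rintegral_cst//= lebesgue_measure_itv /= lte_fin mul1r.
case: ltP => h /=; last by rewrite subr_ge0.
have [v0|v0] := leP v 0; have [u0|u0] := leP u 0; lra.
Qed.

End primitive.

(** * Clarke subdifferentials *)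

Section limf_esup.
Context {R : realType} {U : choiceType} {T : filteredType U}.
Local Open Scope ereal_scope.
Implicit Types (F : set_system T) (h : T -> \bar R).

Lemma limf_esup_le_sup F h (V : set T) : F V -> limf_esup h F <= ereal_sup (h @` V).
Proof. by move=> FV; apply: ereal_inf_lbound; exists V. Qed.

Lemma limf_esup_le F (FF : Filter F) h1 h2 :
  (\forall p \near F, h1 p <= h2 p) -> limf_esup h1 F <= limf_esup h2 F.
Proof.
move=> UF; apply: le_ereal_inf_tmp => _ [V FV <-].
apply: le_trans (limf_esup_le_sup _ (filterI FV UF)) _.
apply: ge_ereal_sup => _ [p [Vp Up] <-].
by apply: le_trans Up _; apply: ereal_sup_ubound; exists p.
Qed.

Lemma limf_esup_le_cst F (FF : Filter F) h c :
  (\forall p \near F, h p <= c) -> limf_esup h F <= c.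
Proof.
move=> UF; apply: le_trans (limf_esup_le_sup _ UF) _.
by apply: ge_ereal_sup => _ [p Up <-].
Qed.

Lemma limf_esup_ge_cst F (FF : ProperFilter F) h c :
  (\forall p \near F, c <= h p) -> c <= limf_esup h F.
Proof.
move=> UF; apply: le_ereal_inf_tmp => _ [V FV <-].
have [p [Vp Up]] := filter_ex (filterI FV UF).
by apply: le_trans Up _; apply: ereal_sup_ubound; exists p.
Qed.

End limf_esup.

Section clarke_theory.
Context {R : realType}.
Implicit Types (x y u v z a e : R) (h : R -> R).

(** Localizes the difference quotient: both points at which [h] is evaluated are eventually close to
    [x]. *)
Lemma clarke_near x v e : 0 < e ->
  \forall p \near filter_prod (nbhs x) (0 : R)^'+,
    [/\ 0 < p.2, `|p.1 - x| < e & `|p.1 + p.2 * v - x| < e].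
Proof.
move=> e0; have e20 : 0 < e / 2 by rewrite divr_gt0.
have v0 : 0 < `|v| + 1 by rewrite ltr_wpDl.
(* Half of [e] is spent on the base point and half on the displacement [t * v]; the [+ 1] covers
   [v = 0]. *)
exists (ball x (e / 2), [set t | 0 < t < e / 2 / (`|v| + 1)]) => /=.
  split; first exact: nbhsx_ballx.
  near=> t; apply/andP; split; near: t; first exact: nbhs_right_gt.
  by apply: nbhs_right_lt; rewrite divr_gt0.
move=> [y t] /=; rewrite /ball /= distrC => -[yx /andP[t0]].
rewrite ltr_pdivlMr// => te; split => //; first by apply: lt_trans yx _; lra.
rewrite (_ : _ - x = (y - x) + t * v); last ring.
apply: le_lt_trans (ler_normD _ _) _; rewrite normrM (gtr0_norm t0).
have : 0 <= `|v| by [].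
nra.
Unshelve. all: by end_near. Qed.

Lemma clarke_subdiff_germ h1 h2 x e : 0 < e ->
  (forall y z, y <= z -> `|y - x| < e -> `|z - x| < e -> h1 z - h1 y = h2 z - h2 y) ->
  clarke_subdiff h1 x = clarke_subdiff h2 x.
Proof.
move=> e0 E.
have E' y z : `|y - x| < e -> `|z - x| < e -> h1 z - h1 y = h2 z - h2 y.
  move=> ye ze; have [yz|/ltW zy] := leP y z; first exact: E.
  by rewrite -opprB E// opprB.
suff D v : clarke_dderiv h1 x v = clarke_dderiv h2 x v.
  by apply/seteqP; split => z hz v; have := hz v; rewrite D.
apply/eqP; rewrite eq_le /clarke_dderiv; apply/andP; split; apply: limf_esup_le;
  near=> p; rewrite E' ?lexx//; by near: p; apply: filterS (clarke_near x v e0) => p [].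
Unshelve. all: by end_near. Qed.

(** The derivative in direction [v] is [a * v]; the directions 1 and -1 then pin [z] to [a]. *)
Lemma clarke_subdiff_affine h x a e : 0 < e ->
  (forall y z, y <= z -> `|y - x| < e -> `|z - x| < e -> h z - h y = a * (z - y)) ->
  clarke_subdiff h x = [set a].
Proof.
move=> e0 E; rewrite (@clarke_subdiff_germ h ( *%R a) x e)//; last first.
  by move=> y z yz ye ze; rewrite E// mulrBr.
have D v : clarke_dderiv ( *%R a) x v = (a * v)%:E.
  have Q : \forall p \near filter_prod (nbhs x) (0 : R)^'+,
      (a * (p.1 + p.2 * v) - a * p.1) / p.2 = a * v.
    apply: filterS (clarke_near x v e0) => p [p0 _ _].
    by have : p.2 != 0 by [rewrite gt_eqF]; move=> ?; field.
  apply/eqP; rewrite eq_le /clarke_dderiv; apply/andP; split.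
    by apply: limf_esup_le_cst; apply: filterS Q => p ->.
  by apply: limf_esup_ge_cst; apply: filterS Q => p ->.
apply/seteqP; split => [z hz|_ -> v]; last by rewrite D.
have := hz 1; have := hz (-1); rewrite !D !lee_fin => h1 h2.
by apply/eqP; rewrite eq_le; apply/andP; split; lra.
Qed.

(** Monotonicity tested in direction -1 gives [0 <= z], the Lipschitz bound in direction 1 gives
    [z <= 1]. *)
Lemma clarke_subdiff_sub01 h x :
  (forall u v, u <= v -> 0 <= h v - h u <= v - u) ->
  clarke_subdiff h x `<=` `[0, 1]%classic.
Proof.
move=> H z hz; rewrite /= in_itv /=; apply/andP; split.
  have : (clarke_dderiv h x (-1) <= 0%:E)%E.
    apply: limf_esup_le_cst; apply: filterS (clarke_near x 0 ltr01) => p [p0 _ _].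
    rewrite lee_fin pmulr_lle0 ?invr_gt0// -oppr_ge0 opprB.
    have yt : p.1 + p.2 * -1 <= p.1 by lra.
    by case/andP: (H _ _ yt).
  by move=> /(le_trans (hz (-1))); rewrite lee_fin; lra.
have : (clarke_dderiv h x 1 <= 1%:E)%E.
  apply: limf_esup_le_cst; apply: filterS (clarke_near x 0 ltr01) => p [p0 _ _].
  rewrite lee_fin ler_pdivrMr//.
  have yt : p.1 <= p.1 + p.2 * 1 by lra.
  by case/andP: (H _ _ yt); lra.
by move=> /(le_trans (hz 1)); rewrite lee_fin; lra.
Qed.

Lemma clarke_subdiff_convex h x z0 z1 z : clarke_subdiff h x z0 ->
  clarke_subdiff h x z1 -> z0 <= z <= z1 -> clarke_subdiff h x z.
Proof.
move=> h0 h1 /andP[zz0 zz1] v; have [v0|v0] := leP 0 v.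
  by apply: le_trans (h1 v); rewrite lee_fin ler_wpM2r.
by apply: le_trans (h0 v); rewrite lee_fin ler_wnM2r// ltW.
Qed.

(** The limsup is an infimum of suprema over sets [V] containing some [A] times [B], with [A] a
    neighbourhood of [x0]. Eventually [A] is also a neighbourhood of [u n], so the supremum over the
    same [V] bounds [z n * v]; let [n] grow. *)
Lemma clarke_subdiff_osc h : outer_semicontinuous (clarke_subdiff h).
Proof.
move=> u z x0 z0 ux S zz v; apply: le_ereal_inf_tmp => _ [V [[A B] /= [xA B0] AB] <-].
have uA : \forall n \near \oo, ((z n * v)%:E <= ereal_sup
    [set ((h (p.1 + p.2 * v) - h p.1) / p.2)%:E | p in V])%E.
  have : \forall n \near \oo, nbhs (u n) A.
    exact: (ux _ (nbhs_interior xA)).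
  apply: filterS => n An; apply: le_trans (S n v) _.
  by apply: limf_esup_le_sup; exists (A, B).
apply: (@cvge_to_le _ _ _ _ (fun n => (z n * v)%:E)) uA.
by apply: cvg_EFin; [exact: nearW|apply: cvgMl].
Qed.

End clarke_theory.

(** * Subdifferentials of the integrand and their measurability in [xi] *)

Section subdifferential.
Context {R : realType}.
Implicit Types (x y t xi : R) (k n : nat).

Lemma clarke_subdiff_f01 xi x : clarke_subdiff (f xi) x `<=` `[0, 1]%classic.
Proof. by apply: clarke_subdiff_sub01 => u v; exact: f_sub_bounds. Qed.

Lemma between_ball x y z t e : `|y - x| < e -> `|z - x| < e -> y < t <= z ->
  `|t - x| < e.
Proof. by rewrite !ltr_norml => /andP[? ?] /andP[? ?] /andP[? ?]; apply/andP; split; lra. Qed.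

Lemma bump_gt0 k x : (0 < k)%N -> bump_set k x -> 0 < x.
Proof. by move=> k0 /(bump_setP k0)[+ _]; apply: lt_trans; rewrite mulr_gt0// invr_gt0 ltr0n. Qed.

Lemma clarke_subdiff_bump xi k x : (0 < k)%N -> bump_set k x ->
  clarke_subdiff (f xi) x = [set (bit k xi)%:~R].
Proof.
move=> k0 hk; have /nbhs_ballP[e /= e0 eB] := open_nbhs_nbhs (conj (@open_bump R k) hk).
have inB t : `|t - x| < e -> bump_set k t by move=> h; apply: eB; rewrite /ball /= distrC.
apply: (@clarke_subdiff_affine _ _ _ _ e) => // y z yz ye ze.
rewrite (@f_sub_cst _ _ _ _ (bit k xi)%:~R)// => [|t yt _].
  by rewrite !max_l// ltW// (bump_gt0 k0)//; exact: inB.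
by apply: (@g_bump _ _ k) => //; apply/inB/between_ball/yt.
Qed.

Lemma clarke_subdiff_lt0 xi x : x < 0 -> clarke_subdiff (f xi) x = [set 0].
Proof.
move=> x0; apply: (@clarke_subdiff_affine _ _ _ _ (- x)) => [|y z yz ye ze].
  by rewrite oppr_gt0.
rewrite (@f_sub_cst _ _ _ _ 0) ?mul0r// => t yt t0.
by have := between_ball ye ze yt; rewrite ltr_norml => /andP[_]; lra.
Qed.

Lemma eq_clarke_subdiff xi xi' x e : 0 < e ->
  (forall k t, (0 < k)%N -> `|t - x| < e -> bump_set k t -> bit k xi = bit k xi') ->
  clarke_subdiff (f xi) x = clarke_subdiff (f xi') x.
Proof.
move=> e0 E; apply: (clarke_subdiff_germ e0) => y z yz ye ze.
apply: eq_f_sub => // t yt; apply: eq_g => k k0 hk.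
by apply: (E k t) => //; apply: between_ball yt.
Qed.

Lemma clarke_subdiff_dyadic x : x != 0 -> exists N : nat, forall xi xi',
  Num.floor (2 ^+ N * xi) = Num.floor (2 ^+ N * xi') ->
  clarke_subdiff (f xi) x = clarke_subdiff (f xi') x.
Proof.
move=> x0; have ax0 : 0 < `|x| by rewrite normr_gt0.
(* For [x > 0], a bump [k] with a point [t] closer to [x] than [x / 2] satisfies
   [x / 2 < t < 2 / k], so [k < 4 / x]. For [x < 0] no bump comes that close, as bumps are
   positive. *)
exists (Num.bound (4 / x)) => xi xi' E.
apply: (@eq_clarke_subdiff _ _ _ (`|x| / 2)) => [|k t k0]; first by rewrite divr_gt0.
move=> tx hk; have t0 := bump_gt0 k0 hk.
have x_gt0 : 0 < x.
  move: tx; rewrite lt0r x0 /= ltr_norml; case: (ltP x 0) => [xn|//].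
  by rewrite ltr0_norm// => /andP[_]; lra.
apply: (bit_dyadic _ E); rewrite -(ler_nat R) ltW//.
apply: le_lt_trans (archi_boundP _); last by rewrite divr_ge0// ltW.
have [_] := bump_setP k0 hk; move: tx; rewrite (gtr0_norm x_gt0) ltr_norml.
move=> /andP[h _] tk; have {tk} : x / 2 < 2 / k%:R by lra.
by rewrite ltr_pdivlMr ?ltr0n// ler_pdivlMr//; nra.
Qed.

(** All bits of 0 vanish, so [f 0] serves as a reference; measurability only uses that the set is
    the same for all such [xi]. *)
Lemma clarke_subdiff0_fin xi N : (forall k, (N <= k)%N -> bit k xi = 0) ->
  clarke_subdiff (f xi) 0 = clarke_subdiff (f 0) 0.
Proof.
move=> h; have N0 : 0 < (N.+1%:R : R) by rewrite ltr0n.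
(* Bump [k] lies to the right of [1/(2k)], so only bumps with [k > N.+1] meet this ball. *)
apply: (@eq_clarke_subdiff _ _ _ (2^-1 / N.+1%:R)) => [|k t k0].
  by rewrite divr_gt0.
rewrite subr0 => te hk; rewrite bit0 h//.
have [+ _] := bump_setP k0 hk; have := bump_gt0 k0 hk => t0 tk.
have : 2^-1 * k%:R^-1 < 2^-1 / N.+1%:R :> R by rewrite (lt_trans tk)// -(gtr0_norm t0).
by rewrite ltr_pM2l// ltf_pV2 ?posrE ?ltr0n// ltr_nat => /ltnW/ltnW.
Qed.

(* 0 and 1 are limits of subgradients at [- n.+1%:R^-1] and at the centers of the
   bumps carrying a bit 1. *)
Lemma clarke_subdiff0_inf xi : (forall N, exists2 k, (N <= k)%N & bit k xi = 1) ->
  clarke_subdiff (f xi) 0 = `[0, 1]%classic.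
Proof.
move=> h; apply/seteqP; split; first exact: clarke_subdiff_f01.
have S0 : clarke_subdiff (f xi) 0 0.
  apply: (@clarke_subdiff_osc _ _ (fun n => - n.+1%:R^-1) (cst 0)).
  - rewrite -[X in _ --> X]oppr0; apply: cvgN; exact: cvg_harmonic.
  - by move=> n; rewrite clarke_subdiff_lt0// oppr_lt0 invr_gt0 ltr0n.
  - exact: cvg_cst.
have [k nk bk] : exists2 k : nat -> nat, (forall n, (n.+1 <= k n)%N) & forall n, bit (k n) xi = 1.
  have /choice[k hk] : forall n, exists k, (n.+1 <= k)%N /\ bit k xi = 1.
    by move=> n; have [k ? ?] := h n.+1; exists k.
  by exists k => n; case: (hk n).
have S1 : clarke_subdiff (f xi) 0 1.
  apply: (@clarke_subdiff_osc _ _ (fun n => (k n)%:R^-1) (cst 1)).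
  - apply: (@squeeze_cvgr _ _ _ _ (cst 0) (fun n => n.+1%:R^-1)).
    + apply: nearW => n; have kn0 := leq_ltn_trans (leq0n n) (nk n).
      by rewrite invr_ge0 ler0n /= lef_pV2 ?posrE ?ltr0n// ler_nat.
    + exact: cvg_cst.
    + exact: cvg_harmonic.
  - move=> n; have kn0 := leq_ltn_trans (leq0n n) (nk n).
    by rewrite (clarke_subdiff_bump _ kn0 (bump_center kn0)) bk.
  - exact: cvg_cst.
by move=> z; rewrite /= in_itv /=; exact: clarke_subdiff_convex.
Qed.

Lemma measurable_clarke_subdiff x :
  set_measurable `[0, 1]%classic (fun xi => clarke_subdiff (f xi) x).
Proof.
move=> C _.
pose A := [set xi : R | clarke_subdiff (f xi) x `&` C !=set0].
suff mA : measurable A by apply: measurableI mA; exact: measurable_itv.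
rewrite {}/A; have [->|x0] := eqVneq x 0; last first.
  have [N hN] := clarke_subdiff_dyadic x0.
  by apply: (@measurable_dyadic _ N) => xi xi' /hN /= ->.
(* The [xi] with infinitely many bits 1. *)
pose I : set R := \bigcap_N \bigcup_(k in [set k | (N <= k)%N]) [set xi | bit k xi = 1].
have mI : measurable I.
  apply: bigcapT_measurable => N; apply: bigcup_measurable => k _.
  exact: measurable_bit.
(* On [I] and on its complement the subdifferential at 0 is constant, so whether it meets [C] is a
   fixed proposition that keeps or discards the whole piece. *)
pose B (P : Prop) (A : set R) := if `[< P >] then A else set0.
have mB P A : measurable A -> measurable (B P A) by rewrite /B; case: ifP.
suff -> : (fun xi => clarke_subdiff (f xi) 0 `&` C !=set0) =
    B (`[0, 1]%classic `&` C !=set0) I `|`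
    B (clarke_subdiff (f 0) 0 `&` C !=set0) (~` I).
  by apply: measurableU; apply: mB => //; exact: measurableC.
have BE P A t : B P A t <-> P /\ A t by rewrite /B; case: asboolP => p; split=> [|[]].
apply/predeqP => xi; apply: (@iff_trans _
  ((`[0, 1]%classic `&` C !=set0 /\ I xi) \/
   (clarke_subdiff (f 0) 0 `&` C !=set0 /\ ~ I xi))); last first.
  by split=> -[h|h]; [left; exact: (BE _ I xi).2 h|right; exact: (BE _ (~` I) xi).2 h
    |left; exact: (BE _ I xi).1 h|right; exact: (BE _ (~` I) xi).1 h].
have [Ixi|nI] := pselect (I xi).
  rewrite clarke_subdiff0_inf; last by move=> N; have [k] := Ixi N Logic.I; exists k.
  by split=> [?|[[]|[_ []]]//]; left.
suff [N hN] : exists N, forall k, (N <= k)%N -> bit k xi = 0.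
  by rewrite (clarke_subdiff0_fin hN); split=> [?|[[]|[]]//]; right.
apply: contrapT => /forallNP hN; apply: nI => N _.
(* [N.+1] makes the index positive, as [bit01] requires. *)
have /existsNP[k /not_implyP[Nk bk]] := hN N.+1.
exists k; first exact: ltnW.
by case: (bit01 xi (leq_ltn_trans (leq0n N) Nk)).
Qed.

End subdifferential.

(** * Uniformly distributed bits *)

Section uniform.
Context {R : realType}.
Implicit Types (x y : R) (k n : nat) (A : set R).
Local Notation mu := (@lebesgue_measure R).
Local Notation U := (uniform_prob (@ltr01 R)).
Local Open Scope ereal_scope.

Lemma uniform_prob01E A : measurable A -> U A = mu (A `&` `[0%R, 1%R]).
Proof.
move=> mA; rewrite /uniform_prob integral_uniform_pdf (eq_integral (cst 1)).
  by rewrite integral_cst ?mul1e//; exact: measurableI.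
move=> x; rewrite inE => -[_]; rewrite /= in_itv /= /uniform_pdf => ->.
by rewrite subr0 invr1.
Qed.

(** Points of [[0, 1)] sharing their first [n] bits lie in one dyadic interval of length [2^-n]. The
    point 1, whose integer part differs, is split off as a null set. *)
Lemma uniform_prob_same_bits n A : measurable A ->
  (forall x y, A x -> A y -> forall k, (0 < k <= n)%N -> bit k x = bit k y) ->
  U A <= (2^-1 ^+ n)%:E.
Proof.
move=> mA hA; rewrite uniform_prob01E//.
have n0 : (0 < 2 ^+ n :> R)%R by rewrite exprn_gt0.
have mI a b : measurable (`[a, b]%classic : set R) by exact: measurable_itv.
have floor01 (z : R) : (0 <= z < 1)%R -> Num.floor z = 0%R by move=> z01; apply/eqP; rewrite floor_eq add0r.
have [[y [Ay]]|h] := pselect (exists y, A y /\ (0 <= y < 1)%R); last first.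
  apply: (@le_trans _ _ (mu [set 1%R])).
    apply: le_measure; rewrite ?inE//; first exact: measurableI.
    move=> x [Ax] /=; rewrite in_itv /= => /andP[x0].
    by rewrite le_eqVlt => /predU1P[->//|x1]; case: h; exists x; rewrite x0.
  by rewrite lebesgue_measure_set1 lee_fin exprn_ge0.
move=> y01; pose m : R := (Num.floor (2 ^+ n * y))%:~R.
apply: (@le_trans _ _ (mu (`[(m / 2 ^+ n)%R, ((m + 1) / 2 ^+ n)%R]%classic `|` [set 1%R]))).
  apply: le_measure; rewrite ?inE//; [exact: measurableI|exact: measurableU|].
  move=> x [Ax] /=; rewrite in_itv /= => /andP[x0].
  rewrite le_eqVlt => /predU1P[->|x1]; [by right|left].
  have E : Num.floor (2 ^+ n * x) = Num.floor (2 ^+ n * y).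
    apply: dyadic_bits => [|k kn]; last exact: hA.
    by rewrite !floor01// x0.
  rewrite in_itv /= ler_pdivrMr// ler_pdivlMr// mulrC /m -E.
  by have /andP[-> /ltW] := floor_itv (2 ^+ n * x); rewrite intrD.
apply: le_trans (measureU2 _ _ _) _ => //.
rewrite [X in _ + X]lebesgue_measure_set1 adde0 /= lebesgue_measure_itv /= lte_fin.
case: ifP => _; last by rewrite lee_fin exprn_ge0.
by rewrite -EFinB lee_fin exprVn -mulrBl addrAC subrr add0r mul1r.
Qed.

End uniform.

(** * Union bounds over bit patterns *)

Section finite_union.
Context {d : measure_display} {T : measurableType d} {R : realType}.
Variable P : {measure set T -> \bar R}.
Local Open Scope ereal_scope.

Lemma measure_bigsetU_card_le (I : finType) (p : pred I) (E : I -> set T) (c : R) :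
  (forall i, measurable (E i)) -> (forall i, P (E i) <= c%:E) ->
  P (\big[setU/set0]_(i | p i) E i) <= (#|p|%:R * c)%:E.
Proof.
move=> mE Pc; rewrite -sum1_card natr_sum mulr_suml -sumEFin.
suff [] : measurable (\big[setU/set0]_(i | p i) E i) /\
  P (\big[setU/set0]_(i | p i) E i) <= \sum_(i | p i) (1%:R * c)%:E by [].
apply: (big_rec2 (fun X s => measurable X /\ P X <= s)).
  by rewrite measure0; split.
move=> i s X _ [mX hX]; split; first exact: measurableU.
apply: le_trans (measureU2 _ _ _) _ => //; apply: leeD => //.
by rewrite mul1r; exact: Pc.
Qed.

Lemma measure_cover_card_le (I : finType) (p : pred I) (A : set T)
    (E : I -> set T) (c : R) :
  measurable A -> (forall i, measurable (E i)) -> (forall i, P (E i) <= c%:E) ->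
  (forall x, A x -> exists2 i, p i & E i x) -> P A <= (#|p|%:R * c)%:E.
Proof.
move=> mA mE Pc AE; apply: le_trans (measure_bigsetU_card_le p mE Pc).
apply: le_measure; rewrite ?inE//; first exact: bigsetU_measurable.
by move=> x /AE[i pi Ex]; rewrite (bigD1 i)//=; left.
Qed.

End finite_union.

Section uniform_bit.
Context {R : realType}.
Local Notation U := (uniform_prob (@ltr01 R)).
Local Open Scope ereal_scope.

(** Splitting by the first [n] bits covers the event by [2^n] sets of probability at most
    [2^-(n+1)]. *)
Lemma uniform_bit_le (n : nat) (b : int) : U [set x | bit n.+1 x = b] <= (2^-1)%:E.
Proof.
pose E (M : {ffun 'I_n -> bool}) : set R := [set x | bit n.+1 x = b /\
  forall i : 'I_n, bit i.+1 x = (M i : nat)].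
have mE M : measurable (E M).
  apply: (@measurable_dyadic _ n.+1) => x y xy [xb h]; split.
    by rewrite -(bit_dyadic (leqnn _) xy).
  by move=> i; rewrite -h (@bit_dyadic _ _ _ _ _ _ xy)// ltnS ltnW.
have UE M : U (E M) <= (2^-1 ^+ n.+1)%:E.
  apply: uniform_prob_same_bits => // x y [xb xM] [yb yM] [//|k] /=.
  rewrite ltnS leq_eqVlt => /predU1P[->|kn]; first by rewrite xb yb.
  by have := xM (Ordinal kn); have := yM (Ordinal kn) => /= -> ->.
have := @measure_cover_card_le _ _ R U _ predT _ E (2^-1 ^+ n.+1)%R (measurable_bit n.+1 b) mE UE.
move=> /(_ _)/le_trans; apply.
  move=> x xb; exists [ffun i : 'I_n => bit i.+1 x == 1%R] => //.
  split=> // i; rewrite ffunE.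
  by case: (bit01 x (ltn0Sn i)) => ->.
rewrite lee_fin (_ : #|_| = #|{ffun 'I_n -> bool}|); last by apply: eq_card.
rewrite card_ffun card_bool card_ord natrX exprS mulrCA -exprMn divff//.
by rewrite expr1n mulr1.
Qed.

(** Both values have probability at most 1/2 and together at least 1, which forces equality. *)
Lemma uniform_bit (k : nat) : (0 < k)%N -> U [set x | bit k x = 1%R] = (2^-1)%:E.
Proof.
case: k => // n _; apply/eqP; rewrite eq_le uniform_bit_le /=.
have UT : U setT = 1 by exact: probability_setT.
have : U setT <= U [set x | bit n.+1 x = 0%R] + U [set x | bit n.+1 x = 1%R].
  rewrite (_ : setT = [set x | bit n.+1 x = 0%R] `|` [set x | bit n.+1 x = 1%R]).
    by apply: measureU2; exact: measurable_bit.
  by apply/esym/seteqP; split => // x _; exact: bit01.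
rewrite UT => /le_trans/(_ (leeD2r _ (uniform_bit_le n 0))).
have : U [set x | bit n.+1 x = 1%R] \is a fin_num by apply: fin_num_measure; exact: measurable_bit.
by move=> /fineK <-; rewrite -EFinD !lee_fin; lra.
Qed.

End uniform_bit.

Lemma nneseries_inv_sqr_lty (R : realType) (u : nat -> \bar R) :
  (forall n, 0 <= u n)%E -> (forall n, u n <= ((n.+1%:R ^+ 2)^-1)%:E)%E ->
  (\sum_(0 <= n <oo) u n < +oo)%E.
Proof.
move=> u0 uh; apply: (@le_lt_trans _ _ 2%:E); last by rewrite ltry.
apply: lime_le; first by apply: is_cvg_nneseries => n _ _.
apply: nearW => n.
(* Telescoping bound; with [a = n.+1], the induction step holds with slack [1/(a(a + 1)^2)]. *)
suff : (\sum_(0 <= i < n.+1) u i <= (2 - n.+1%:R^-1)%:E)%E.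
  move=> h; apply: (@le_trans _ _ (\sum_(0 <= i < n.+1) u i)%E).
    by rewrite big_nat_recr//= leeDl.
  by apply: le_trans h _; rewrite lee_fin gerBl invr_ge0.
elim: n => [|n IH].
  by rewrite big_nat1 (le_trans (uh 0))// lee_fin expr1n invr1; lra.
rewrite big_nat_recr//=; apply: le_trans (leeD IH (uh _)) _.
rewrite -EFinD lee_fin.
have n0 : 0 < (n.+1%:R : R) by rewrite ltr0n.
rewrite -[n.+2%:R]natr1; set a : R := n.+1%:R in n0 *.
have a1 : 0 < a + 1 by lra.
have -> : 2 - a^-1 + ((a + 1) ^+ 2)^-1 = 2 - (a + 1)^-1 - (a * (a + 1) ^+ 2)^-1.
  by field; rewrite !gt_eqF.
by rewrite gerBl invr_ge0 ltW// mulr_gt0// exprn_gt0.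
Qed.

(** * Almost surely, some bit is 1 in all of the first [n] samples, for every large [n] *)

Section all_ones.
Context {d : measure_display} {T : measurableType d} {R : realType}.
Variables (P : probability T R) (xi : nat -> {RV P >-> R}).
Hypothesis xi_indep : mutually_independent xi.
Hypothesis xi_unif : forall i, uniformly_distributed01 (xi i).

Lemma prob_same_bits K n (A : nat -> set R) : (forall j, measurable (A j)) ->
  (forall j x y, (0 < j <= n)%N -> A j x -> A j y ->
     forall k, (0 < k <= K)%N -> bit k x = bit k y) ->
  (P (\bigcap_(j in [set` iota 1 n]) (xi j @^-1` A j)) <= ((2^-1 ^+ K) ^+ n)%:E)%E.
Proof.
move=> mA hA; rewrite xi_indep ?iota_uniq//.
have {hA}: forall j, j \in iota 1 n -> (P (xi j @^-1` A j) <= (2^-1 ^+ K)%:E)%E.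
  move=> j; rewrite mem_iota add1n ltnS => jn.
  rewrite -[leLHS]/(distribution P (xi j) (A j)) xi_unif//.
  by apply: uniform_prob_same_bits => // x y Ax Ay; exact: hA jn Ax Ay.
(* The exponent becomes the length of the index list, so that induction on the list applies. *)
rewrite -[n in X in (_ <= X)%E](size_iota 1).
elim: (iota 1 n) => [|j s IH] hs; first by rewrite big_nil expr0.
rewrite big_cons /= exprS EFinM; apply: lee_pmul => //.
- by elim/big_ind: _ => // x y; exact: mule_ge0.
- by apply: hs; rewrite mem_head.
- by apply: IH => i si; apply: hs; rewrite in_cons si orbT.
Qed.

(* The first K bits of [xi 1], ..., [xi n] form a K x n bit matrix, each value of
   which has probability at most 2^-(K n); [(2^n - 1)^K] of them have no row of ones. *)
Let rows K n : finType := {ffun 'I_K -> {ffun 'I_n -> bool}}.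

Let no_full_row K n : pred (rows K n) := ffun_on (predC1 [ffun=> true]).

(** The constraint that [M] puts on [xi j]. Quantifying over [i] with [i.+1 = j] converts the index
    to an ordinal and leaves [j] outside [1..n] unconstrained. *)
Let col K n (M : rows K n) (j : nat) : set R :=
  [set x | forall (k : 'I_K) (i : 'I_n), i.+1 = j -> bit k.+1 x = (M k i : nat)].

Let event K n (M : rows K n) : set T :=
  \bigcap_(j in [set` iota 1 n]) (xi j @^-1` col M j).

Definition no_all_ones K n : set T :=
  \big[setU/set0]_(M : rows K n | no_full_row M) event M.

Let measurable_col K n (M : rows K n) j : measurable (col M j).
Proof.
apply: (@measurable_dyadic _ K) => x y xy h k i ij.
by rewrite -(h k i ij) (@bit_dyadic _ _ _ _ _ _ xy).
Qed.

Let measurable_event K n (M : rows K n) : measurable (event M).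
Proof.
rewrite /event bigcap_seq; apply: bigsetI_measurable => j _.
rewrite -[X in measurable X]setTI; exact: (measurable_funPT (xi j)).
Qed.

Lemma measurable_no_all_ones K n : measurable (no_all_ones K n).
Proof. by apply: bigsetU_measurable => M _. Qed.

Lemma no_all_onesP K n w : ~ no_all_ones K n w ->
  exists2 k, (0 < k <= K)%N & forall i, (0 < i <= n)%N -> bit k (xi i w) = 1.
Proof.
move=> nw; apply: contrapT => h; apply: nw.
(* The bit matrix observed at [w]: without a row of ones, it places [w] in one of the events of the
   union. *)
pose M : rows K n := [ffun k : 'I_K => [ffun i : 'I_n => bit k.+1 (xi i.+1 w) == 1]].
rewrite /no_all_ones (bigD1 M)/=; last first.
  apply/ffun_onP => k; rewrite inE; apply/eqP => Mk; apply: h.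
  exists k.+1 => [|[//|i] /= ile]; first exact: ltn_ord.
  have := congr1 (fun r : {ffun 'I_n -> bool} => r (Ordinal ile)) Mk.
  by rewrite !ffunE => /eqP.
left => j _ /= k i <-; rewrite !ffunE.
by case: (bit01 (xi i.+1 w) (ltn0Sn k)) => ->.
Qed.

Lemma prob_no_all_ones K n :
  (P (no_all_ones K n) <= ((1 - 2^-1 ^+ n) ^+ K)%:E)%E.
Proof.
have PE (M : rows K n) : (P (event M) <= ((2^-1 ^+ K) ^+ n)%:E)%E.
  apply: prob_same_bits => // j x y /andP[j0 jn] cx cy k /andP[k0 kK].
  case: k j j0 jn k0 kK cx cy => // k [//|j] _ jn _ kK cx cy.
  by rewrite (cx (Ordinal kK) (Ordinal jn))// (cy (Ordinal kK) (Ordinal jn)).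
apply: le_trans (measure_bigsetU_card_le _ (@measurable_event K n) PE) _.
have -> : #|@no_full_row K n| = ((2 ^ n).-1 ^ K)%N.
  by rewrite card_ffun_on cardC1 card_ffun card_bool !card_ord.
(* Count and probability become the [K]-th powers of [2^n - 1] and [2^-n], which merge into one. *)
rewrite lee_fin natrX -exprM mulnC exprM.
rewrite -exprMn -subn1 natrB ?expn_gt0// natrX mulrBl mul1r -exprMn.
by rewrite mulfV// expr1n.
Qed.

Definition nrows n : nat := `|Num.ceil (2 ^+ n.+1 * ln (n.+1%:R : R))|%N.

Lemma nrowsE n : (nrows n)%:R = (Num.ceil (2 ^+ n.+1 * ln (n.+1%:R : R)))%:~R :> R.
Proof.
rewrite /nrows natr_absz ger0_norm// ceil_ge0 (lt_le_trans (ltrN10 R))//.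
by rewrite mulr_ge0// ln_ge0// ler1n.
Qed.

Lemma prob_no_all_ones_nrows n :
  (P (no_all_ones (nrows n) n) <= ((n.+1%:R ^+ 2)^-1)%:E)%E.
Proof.
apply: le_trans (prob_no_all_ones _ _) _; rewrite lee_fin.
have p1 : 2^-1 ^+ n <= 1 :> R by rewrite exprn_ile1// invf_le1// ler1n.
apply: (@le_trans _ _ (expR (- 2^-1 ^+ n) ^+ nrows n)).
  by rewrite lerXn2r ?nnegrE ?expR_ge0 ?subr_ge0// expR_ge1Dx.
rewrite -expRM_natr nrowsE -[leRHS]lnK ?posrE ?invr_gt0 ?exprn_gt0 ?ltr0n//.
rewrite ler_expR lnV ?posrE ?exprn_gt0 ?ltr0n// lnXn ?ltr0n// mulNr lerN2.
(* The exponent [n.+1] in the ceiling, against [2^-n], leaves [2 ln(n+1)]; this factor 2 makes the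
   bound summable. *)
apply: (@le_trans _ _ (2^-1 ^+ n * (2 ^+ n.+1 * ln n.+1%:R))).
  by rewrite exprS mulrA mulrCA -exprMn mulVf// expr1n mulr1 mulr_natl.
by rewrite ler_wpM2l ?exprn_ge0// ceil_ge.
Qed.

Lemma ae_all_ones : {ae P, forall w, exists N, forall n, (N <= n)%N ->
  exists2 k, (0 < k <= nrows n)%N & forall i, (0 < i <= n)%N -> bit k (xi i w) = 1}.
Proof.
(* The exceptional outcomes lie in infinitely many bad events, a null set by Borel-Cantelli. *)
exists (lim_sup_set (fun n => no_all_ones (nrows n) n)); split.
- apply: bigcapT_measurable => N; apply: bigcup_measurable => n _.
  exact: measurable_no_all_ones.
- apply: lim_sup_set_cvg0 => [n|]; first exact: measurable_no_all_ones.
  by apply: nneseries_inv_sqr_lty => n //; exact: prob_no_all_ones_nrows.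
- move=> w /= hw N _; apply: contrapT => h; apply: hw; exists N => n Nn.
  by apply: no_all_onesP => hn; apply: h; exists n.
Qed.

End all_ones.

(** * Sample averages, excess and the radius [delta] *)

Section averages.
Context {R : realType}.
Implicit Types (A : nat -> set R) (x y : R).

Lemma mink_avg_ones (n : nat) A : (0 < n)%N ->
  (forall i, (0 < i <= n)%N -> A i = [set 1]) -> mink_avg n A = [set 1].
Proof.
move=> n0 hA.
have S s : (forall i, i \in s -> A i = [set 1]) ->
    \big[@mink_add R/[set 0]]_(i <- s) A i = [set (size s)%:R].
  elim: s => [|i s IH] hs; first by rewrite big_nil.
  rewrite big_cons IH => [|j js]; last by apply: hs; rewrite in_cons js orbT.
  rewrite hs ?mem_head//; apply/seteqP; split => [_ [_ -> [_ ->]] <-|_ ->] /=.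
    by rewrite -natr1 addrC.
  by exists 1 => //; exists (size s)%:R => //; rewrite -natr1 addrC.
rewrite /mink_avg S => [|i]; last by rewrite mem_index_iota ltnS; exact: hA.
rewrite size_iota subn1 /=; apply/seteqP; split => [_ [_ -> <-]|_ ->] /=.
  by rewrite mulVf// pnatr_eq0 -lt0n.
by exists n%:R => //; rewrite mulVf// pnatr_eq0 -lt0n.
Qed.

(** Every point of [D] is [b], and an empty [D] is at infinite distance, so inclusion suffices. *)
Lemma exs_ge_set1 (C D : set R) (a b : R) : C a -> D `<=` [set b] ->
  (`|a - b|%:E <= exs C D)%E.
Proof.
move=> Ca Db; apply: (@le_trans _ _ (dist a D)); last by apply: ereal_sup_ubound; exists a.
by apply: le_ereal_inf_tmp => _ [w /Db -> <-].
Qed.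

Lemma limn_einf_ge (u : nat -> \bar R) (c : \bar R) (N : nat) :
  (forall n, (N <= n)%N -> (c <= u n)%E) -> (c <= limn_einf u)%E.
Proof.
move=> h; rewrite limn_einf_lim; apply: lime_ge; first exact: is_cvg_einfs.
exists N => // n /= Nn; apply: le_ereal_inf_tmp => _ [m /= nm <-].
by apply: h; exact: leq_trans nm.
Qed.

Lemma bump_delta (n k : nat) x y : (0 < k <= @nrows R n)%N ->
  x = k%:R^-1 -> `|x - y| <= delta R n -> bump_set k y.
Proof.
move=> /andP[k0 kn] ->; rewrite /bump_set /= distrC => /le_lt_trans; apply.
(* [1 <= k <= nrows n] keeps [delta] from inverting 0; then [4 k^2 < 8 (nrows n)^2] compares the
   radii. *)
have n0 := leq_trans k0 kn.
rewrite /delta -nrowsE ltf_pV2 ?posrE ?mulr_gt0 ?exprn_gt0 ?ltr0n//.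
have : (0 : R) < k%:R by rewrite ltr0n.
have : (k%:R : R) <= (@nrows R n)%:R by rewrite ler_nat.
by move: (k%:R : R) ((@nrows R n)%:R : R) => a b; nra.
Qed.

End averages.

(** * Aumann expectations on a bump *)

Section aumann_bump.
Context {d : measure_display} {T : measurableType d} {R : realType}.
Variables (P : probability T R) (X : {RV P >-> R}).
Hypothesis X_unif : uniformly_distributed01 X.
Local Notation Xi := (`[0, 1]%classic : set R).

(** [s] is known on [Xi] only, but [X] lies there almost surely, so the integrand agrees almost
    everywhere with the indicator of a fair bit. *)
Lemma expectation_bit (k : nat) (s : R -> R) : (0 < k)%N ->
  measurable_fun setT (fun w => s (X w)) ->
  (forall t, Xi t -> s t = (bit k t)%:~R) ->
  ('E_P[fun w => s (X w)] = (2^-1)%:E)%E.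
Proof.
move=> k0 ms hs; rewrite unlock.
pose B : set T := X @^-1` [set t | bit k t = 1].
have mX (A : set R) : measurable A -> measurable (X @^-1` A).
  by move=> mA; rewrite -[X in measurable X]setTI; exact: (measurable_funPT X).
have mB : measurable B by apply: mX; exact: measurable_bit.
have -> : (\int[P]_w (s (X w))%:E = \int[P]_w (\1_B w)%:E)%E.
  apply: ae_eq_integral => //; first exact/measurable_EFinP.
    by apply/measurable_EFinP; exact: measurable_indic.
  exists (X @^-1` ~` Xi); split.
  - by apply: mX; apply: measurableC; exact: measurable_itv.
  - rewrite -[LHS]/(distribution P X (~` Xi)) X_unif; last first.
      by apply: measurableC; exact: measurable_itv.
    rewrite uniform_prob01E ?setICl ?measure0//.
    by apply: measurableC; exact: measurable_itv.
  - move=> w /= hw /= Xw; apply: hw => _; rewrite hs// indicE.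
    have [b0|b1] := bit01 (X w) k0.
      by rewrite memNset ?b0// => /= b1; move: b0; rewrite b1.
    by rewrite mem_set ?b1.
rewrite integral_indic// setIT -[LHS]/(distribution P X [set t | bit k t = 1]).
by rewrite X_unif ?uniform_bit//; exact: measurable_bit.
Qed.

Lemma aumann_bump (k : nat) (y : R) : (0 < k)%N -> bump_set k y ->
  aumann X Xi (fun t => clarke_subdiff (f t) y) = [set 2^-1].
Proof.
move=> k0 hk; apply/seteqP; split => [e [s [ms hs Is Es]]|_ ->].
  have E := @expectation_bit k s k0 _ _; move: Es; rewrite E => [[]//||].
  - exact/measurable_EFinP/(measurable_int _ Is).
  - by move=> t /hs; rewrite (clarke_subdiff_bump _ k0 hk).
(* The only possible selection on [Xi], written as an indicator to make its measurability
   immediate. *)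
pose s (t : R) : R := \1_[set t : R | bit k t = 1] t.
have sE t : s t = (bit k t)%:~R.
  rewrite /s indicE; have [b0|b1] := bit01 t k0.
    by rewrite memNset ?b0// => /= b1; move: b0; rewrite b1.
  by rewrite mem_set ?b1.
have ms : measurable_fun setT s by apply: measurable_indic; exact: measurable_bit.
have mX : measurable_fun setT (fun w => s (X w)) by exact: measurableT_comp.
exists s; split.
- exact: measurable_funS ms.
- by move=> t _; rewrite (clarke_subdiff_bump _ k0 hk) sE.
- apply: measurable_bounded_integrable => //.
    by rewrite [ltLHS]probability_setT ltry.
  exists 1; split => // M M1 w _ /=.
  rewrite sE; case: (bit01 (X w) k0) => ->; rewrite ?normr0 ?normr1 ?ltW//.
  by rewrite (le_lt_trans _ M1).
- by apply: (@expectation_bit k).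
Qed.

End aumann_bump.

Theorem corollary1 (R : realType) (d : measure_display) (T : measurableType d)
    (P : probability T R) (P_complete : measure_is_complete P)
    (xi : nat -> {RV P >-> R})
    (xi_indep : mutually_independent xi)
    (xi_unif : forall i, uniformly_distributed01 (xi i)) :
  let Xi : set R := `[0, 1]%classic in
  let X : set R := `[0, 1]%classic in
  [/\ (forall t : R, Xi t ->
        outer_semicontinuous (clarke_subdiff (f t)) /\
        forall x : R,
          (ereal_sup [set `|z|%:E | z in clarke_subdiff (f t) x] <= 1%:E)%E),
      (forall x : R, set_measurable Xi (fun t => clarke_subdiff (f t) x)) &
      (forall r : nat -> R,
        (forall nu, (0 < nu)%N -> 0 <= r nu <= delta R nu) ->
        {ae P, forall w,
          ((2^-1)%:E <= limn_einf (fun nu => ereal_sup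
             [set exs
                (mink_avg nu (fun i => clarke_subdiff (f (xi i w)) x))
                (\bigcup_(y in closed_ball_ Num.norm x (r nu) `&` X)
                   aumann (xi 0%N) Xi (fun t => clarke_subdiff (f t) y))
             | x in X]))%E /\
          ((2^-1)%:E <= limn_einf (fun nu => ereal_sup
             [set exs
                (aumann (xi 0%N) Xi (fun t => clarke_subdiff (f t) x))
                (\bigcup_(y in closed_ball_ Num.norm x (r nu) `&` X)
                   mink_avg nu (fun i => clarke_subdiff (f (xi i w)) y))
             | x in X]))%E})].
Proof.
move=> Xi X; split.
- move=> t _; split; first exact: clarke_subdiff_osc.
  move=> x; apply: ge_ereal_sup => _ [z /clarke_subdiff_f01 + <-].
  by rewrite /= in_itv /= => /andP[z0 z1]; rewrite lee_fin ger0_norm.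
- exact: measurable_clarke_subdiff.
move=> r hr; apply: filterS (ae_all_ones xi_indep xi_unif) => w [N hN].
(* The point is the centre [1/k] of a bump whose bit is 1 in all [n] samples. The bound by 1 avoids
   dividing by 0 in the average and gives access to the bound on [r n]. *)
have center n : (maxn N 1 <= n)%N -> exists x, [/\ X x,
    mink_avg n (fun i => clarke_subdiff (f (xi i w)) x) = [set 1],
    aumann (xi 0%N) Xi (fun t => clarke_subdiff (f t) x) = [set 2^-1] &
    forall y, closed_ball_ Num.norm x (r n) y ->
      mink_avg n (fun i => clarke_subdiff (f (xi i w)) y) = [set 1] /\
      aumann (xi 0%N) Xi (fun t => clarke_subdiff (f t) y) = [set 2^-1]].
  rewrite geq_max => /andP[Nn n0]; have [k kn ones] := hN n Nn.
  have k0 : (0 < k)%N by case/andP: kn.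
  have near y : bump_set k y ->
      mink_avg n (fun i => clarke_subdiff (f (xi i w)) y) = [set 1] /\
      aumann (xi 0%N) Xi (fun t => clarke_subdiff (f t) y) = [set 2^-1].
    move=> hy; split; last exact: aumann_bump hy.
    apply: mink_avg_ones => // i /ones b1.
    by rewrite (clarke_subdiff_bump _ k0 hy) b1.
  have [c1 c2] := near _ (bump_center k0).
  exists k%:R^-1; split => //.
    by rewrite /X /= in_itv /= invr_ge0 ler0n invf_le1 ?ltr0n// ler1n.
  move=> y hy; apply: near; apply: (bump_delta kn erefl).
  by apply: le_trans hy _; case/andP: (hr n n0).
have half : (2^-1)%:E = `|1 - 2^-1 : R|%:E by rewrite ger0_norm; [congr EFin|]; lra.
(* The same centre bounds both suprema from below; only the roles of 1 and 1/2 are exchanged. *)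
split; apply: (@limn_einf_ge _ _ _ (maxn N 1)) => n /center[x [Xx avgx aumx nearx]];
  (apply: le_trans; last by apply: ereal_sup_ubound; exists x).
- rewrite avgx [leLHS]half; apply: exs_ge_set1 => // z [y [hy _]].
  by rewrite (nearx y hy).2.
- rewrite aumx [leLHS]half distrC; apply: exs_ge_set1 => // z [y [hy _]].
  by rewrite (nearx y hy).1.
Qed.
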